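(* Let $k \geq 0$ be an integer. Every caterpillar $T$ of diameter $k+1$ all of whose vertices have odd degree, such that $|V(T)| \geq 2^k$ and $|V(T)| = 2^n$ for some integer $n$, is set-sequential.
   Context: A caterpillar is a tree containing a path (the center path) such that every vertex of the tree is at distance at most 1 from that path. The diameter of a connected graph is the largest distance between two of its vertices. A graph $G$ is set-sequential if, for some positive integer $m$, there is an assignment of distinct nonzero vectors of $\mathbb{F}_2^m$ to the vertices of $G$ such that, when each edge is labeled with the sum (mod 2) of the labels of its two endpoints, every nonzero vector of $\mathbb{F}_2^m$ occurs exactly once among all vertex labels and edge labels. *)

(* Defs.v *)
From mathcomp Require Import all_boot all_order all_algebra.

Set Implicit Arguments.
Unset Strict Implicit.
Unset Printing Implicit Defensive.

(* A finite simple graph is a symmetric irreflexive relation e on a finType. *)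
Section Graphs.
Variables (T : finType) (e : rel T).

Definition degree (x : T) : nat := #|[set y | e x y]|.

Definition edges : {set {set T}} :=
  [set E : {set T} | [exists x, exists y, e x y && (E == [set x; y])]].

Definition connected_graph : Prop := 0 < #|T| /\ forall x y, connect e x y.

(* ucycle also accepts the back-and-forth sequence [:: x; y] along an edge,
   which is not a cycle of the graph. *)
Definition acyclic : Prop := forall c : seq T, ucycle e c -> size c <= 2.

Definition is_tree : Prop := connected_graph /\ acyclic.

Definition has_walk (x y : T) (n : nat) : bool :=
  [exists p : n.-tuple T, path e x p && (last x p == y)].

(* The value is the junk #|T| when x and y are not connected. *)
Definition gdist (x y : T) : nat := find (has_walk x y) (iota 0 #|T|).

Lemma has_walkP x y n :
  reflect (exists p, [/\ path e x p, last x p = y & size p = n])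
          (has_walk x y n).
Proof.
apply: (iffP existsP) => [[p /andP[xp /eqP <-]]|[p [xp lp /eqP sp]]].
  by exists p; rewrite size_tuple.
by exists (Tuple sp); rewrite /= xp lp eqxx.
Qed.

Lemma gdist_le x p : path e x p -> gdist x (last x p) <= size p.
Proof.
move=> xp; have [Tp|pT] := leqP #|T| (size p).
  by apply: leq_trans Tp; rewrite -[leqRHS](size_iota 0) find_size.
rewrite leqNgt; apply/negP => /(before_find 0); rewrite nth_iota // add0n.
have -> // : has_walk x (last x p) (size p) by apply/has_walkP; exists p.
Qed.

Lemma gdist_walk x y : connect e x y ->
  exists p, [/\ path e x p, last x p = y & size p = gdist x y].
Proof.
case/connectP => p0 xp0 ->; case/shortenP: xp0 => p xp up _.
have pT : size p < #|T|.
  by have := max_card [in x :: p]; rewrite (card_uniqP up).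
apply/has_walkP; have dT : gdist x (last x p) < #|T|.
  exact: leq_ltn_trans (gdist_le xp) pT.
have := nth_find 0 (a := has_walk x (last x p)) (s := iota 0 #|T|).
rewrite has_find size_iota -/(gdist x (last x p)) nth_iota // add0n.
exact.
Qed.

Definition diameter : nat := \max_(x : T) \max_(y : T) gdist x y.

(* The center path is the vertex sequence x :: p. *)
Definition is_caterpillar : Prop :=
  is_tree /\
  exists (x : T) (p : seq T),
    [/\ path e x p, uniq (x :: p) &
        forall u : T, exists2 v, v \in x :: p & gdist u v <= 1].

Definition edge_label (m : nat) (f : T -> 'rV['F_2]_m) (E : {set T}) :
  'rV['F_2]_m := (\sum_(x in E) f x)%R.

Definition set_sequential : Prop :=
  exists (m : nat) (f : T -> 'rV['F_2]_m),
    [/\ 0 < m, injective f, forall x, f x != 0%R &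
        forall v : 'rV['F_2]_m, v != 0%R ->
          #|[set x | f x == v]| + #|[set E in edges | edge_label f E == v]|
            = 1].

End Graphs.

(* Main.v *)
Require Import Defs.
From mathcomp Require Import all_boot all_order all_algebra zify.

Set Implicit Arguments.
Unset Strict Implicit.
Unset Printing Implicit Defensive.

Import GRing.Theory.

(* Label the vertices v_0, ..., v_(q-1) of a shortest dominating path by unit
   vectors a_i of F_2^(n+1), where q <= n.  A leaf at v_i together with its edge
   is a pair {x, x + a_i}, i.e. an edge of direction i of the cube, so one needs
   a perfect matching of the cube with a prescribed number of edges in every
   direction, containing pairs that cover 0 and the labels of the path.  Fix j
   with v_j of maximal degree; these pairs are {0, a_j}, {a_i, a_i + a_(i-1)} for
   i > j and {a_i, a_i + a_(i+1)} for i < j, and then every direction is needed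
   an even number of times.

   A cube of dimension K >= 2 has a perfect matching with any prescribed even
   numbers of edges per direction with the right sum: cut it along a direction
   used at most twice, or double a matching of a facet along the most frequent
   direction.  To include the path, add the directions in the order j, j+1, ...,
   q-1, j-1, ..., 0 and then the others: each new direction adds a translate of
   the previous subcube, which contains exactly one pair of the path (none for
   the last directions) and is matched with directions already present.  There
   are enough of these because dropping a direction other than j at most halves
   the number of available edges. *)

(** * Counting in multisets, and a bound on the number of odd multiplicities *)

Lemma perm_map_inv (S : eqType) (R : eqType) (g : S -> R) (s : seq S)
    (t : seq R) :
  perm_eq (map g s) t -> exists2 s', perm_eq s s' & map g s' = t.
Proof.
elim: t s => [|y t IH] s st.
  by exists [::] => //; move: (perm_size st); case: s {st}.
have /mapP[x xs yE] : y \in map g s by rewrite (perm_mem st) mem_head.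
have sx := perm_to_rem xs.
have [|s' ss' <-] := IH (rem x s).
  rewrite -(perm_cons y) yE -map_cons -yE.
  by rewrite -(permPr st) perm_sym; apply: perm_map.
by exists (x :: s'); rewrite ?yE //= (permPl sx) perm_cons.
Qed.

Lemma sub_count_split (S : eqType) (s t : seq S) :
  (forall x, count_mem x s <= count_mem x t) ->
  exists u, perm_eq t (s ++ u).
Proof.
case/count_subseqP => s' /perm_to_subseq[u tu] ss'; exists u.
by rewrite (permPl tu) perm_cat2r perm_sym.
Qed.

Lemma expS_gt_quadratic (k : nat) : 3 < k -> k * (k + 3) < 2 ^ k.+1.
Proof.
elim: k => // k IH k3; rewrite expnS.
have [->//|k4] := eqVneq k 3.
have {}IH : k * (k + 3) < 2 ^ k.+1 by apply: IH; lia.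
nia.
Qed.

(* Since c j is at least the average 2 ^ k.+1 / (k + 3), the claim could only
   fail for small k; parity and the bound c >= 2 exclude these cases. *)
Lemma sum_odd_le_max (I : eqType) (c : I -> nat) (j : I) (s : seq I) (k : nat) :
    size s = k.+2 -> {in j :: s, forall i, 1 < c i} ->
    {in s, forall i, c i <= c j} -> c j + \sum_(i <- s) c i = 2 ^ k.+1 ->
  \sum_(i <- s) odd (c i) <= c j.
Proof.
move=> ss c2 cj sc; set t := \sum_(i <- s) _.
have tk : t <= k.+2.
  rewrite -ss /t; elim: (s) => [|i u IH]; first by rewrite big_nil.
  by rewrite big_cons /=; case: odd; lia.
have sumU : \sum_(i <- s) c i <= k.+2 * c j.
  rewrite -ss; elim: (s) cj => [|i u IH] cj; first by rewrite big_nil.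
  rewrite big_cons /= mulSn leq_add ?cj ?mem_head //.
  by apply: IH => x xu; apply: cj; rewrite inE xu orbT.
have c2s : {in s, forall i, 1 < c i} by move=> i si; apply: c2; rewrite inE si orbT.
have sumL : 2 * k.+2 + t <= \sum_(i <- s) c i.
  rewrite -ss /t; elim: (s) c2s => [|i u IH] c2s; first by rewrite !big_nil.
  rewrite !big_cons /=.
  have := c2s i (mem_head _ _); have := IH (fun x xu => c2s x (mem_behead (s := i :: u) xu)).
  have := odd_double_half (c i); have := half_leq (m := 2) (n := c i).
  case: (odd (c i)); lia.
(* The total is even and [t] has the parity of the sum over [s], so [t > c j] improves to
   [t >= c j + 2]. *)
have par : odd (t + c j) = false.
  have : odd (c j + \sum_(i <- s) c i) = false by rewrite sc oddX.
  rewrite !oddD addbC => <-; congr addb; rewrite /t.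
  elim: (s) => [|i u IH]; first by rewrite !big_nil.
  by rewrite !big_cons !oddD IH oddb.
have cj2 : 1 < c j by apply: c2; rewrite mem_head.
rewrite leqNgt; apply/negP => cjt.
have {cjt par}cjt : c j + 2 <= t.
  move: par; have [tE|] := eqVneq t (c j).+1; last lia.
  by rewrite tE addSn /= addnn odd_double.
(* Now [c j <= k], so the total is at most [(k + 3) * c j <= k * (k + 3)], less than [2 ^ k.+1]. *)
have [k3|] := leqP 4 k; first by have := expS_gt_quadratic k3; nia.
by case: k => [|[|[|[|]]]] // in ss sc tk sumU sumL * => _; rewrite ?expnS ?expn0 in sc; lia.
Qed.

Lemma exists_max_in (I : eqType) (c : I -> nat) (s : seq I) :
  s != [::] -> exists2 j, j \in s & {in s, forall i, c i <= c j}.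
Proof.
elim: s => // i s IH _; have [->|/IH[j js jmax]] := eqVneq s [::].
  by exists i; rewrite ?mem_head // => x; rewrite inE => /eqP ->.
have [ij|ji] := leqP (c i) (c j).
  exists j; first by rewrite inE js orbT.
  by move=> x; rewrite inE => /predU1P[->|/jmax].
exists i; first exact: mem_head.
move=> x; rewrite inE => /predU1P[->//|/jmax]; lia.
Qed.

Lemma count_mem_flatten_nseq (I : eqType) (h : I -> nat) (s : seq I) (x : I) :
  uniq s ->
  count_mem x (flatten [seq nseq (h i) i | i <- s]) = (x \in s) * h x.
Proof.
elim: s => //= i s IH /andP[si /IH{}IH].
rewrite count_cat count_nseq IH /= inE [x == i]eq_sym.
by have [<-|_] := eqVneq i x; rewrite ?(negPf si) ?mul1n ?mul0n ?addn0.
Qed.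

Lemma size_flatten_nseq (I : eqType) (h : I -> nat) (s : seq I) :
  size (flatten [seq nseq (h i) i | i <- s]) = \sum_(i <- s) h i.
Proof.
elim: s => [|i s IH]; first by rewrite big_nil.
by rewrite big_cons /= size_cat size_nseq IH.
Qed.

Lemma sum_count_mem (I : eqType) (s E : seq I) :
  uniq s -> {subset E <= s} -> \sum_(i <- s) count_mem i E = size E.
Proof.
move=> us Es; rewrite -size_flatten_nseq; apply: perm_size.
apply/allP => x; rewrite mem_cat => xE; apply/eqP => /=.
rewrite count_mem_flatten_nseq //.
case xs: (x \in s); rewrite ?mul1n // mul0n.
by apply/esym/count_memPn/negP => /Es; rewrite xs.
Qed.
Ltac perm_count :=
  apply/permP => ?; rewrite /= ?(count_cat, count_nseq) /= ?(count_cat, count_nseq) /=; try lia.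

(** * Perfect matchings of cubes with prescribed directions *)

Section Tilings.

Local Open Scope ring_scope.

Variables (V : zmodType) (I : eqType) (A : I -> V).
Hypothesis addVV : forall x : V, x + x = 0.

Implicit Types (p x y : V) (i j : I) (s t D E F G : seq I) (L P : seq (V * I)).

(* Unlike [addrAC], this keeps the structure path of [+] syntactically
   unchanged, as [lia] requires. *)
Let addVAC x y z : x + y + z = x + z + y.
Proof. exact: addrAC. Qed.

(** A multiset: the vectors [A i] need not be independent, so points may repeat, and matchings are
    compared with it up to permutation. *)
Fixpoint cube p s : seq V :=
  if s is i :: s' then cube p s' ++ cube (p + A i) s' else [:: p].

Definition verts L : seq V := flatten [seq [:: d.1; d.1 + A d.2] | d <- L].

(* L completes P to a perfect matching of the cube, and D is the multiset of
   the directions of all the edges. *)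
Definition tiling p s P D : Prop :=
  exists L, perm_eq (verts (P ++ L)) (cube p s) /\
            perm_eq [seq d.2 | d <- P ++ L] D.

Definition shift x L : seq (V * I) := [seq (d.1 + x, d.2) | d <- L].

Lemma verts_cat L1 L2 : verts (L1 ++ L2) = verts L1 ++ verts L2.
Proof. by rewrite /verts map_cat flatten_cat. Qed.

Lemma perm_verts L1 L2 : perm_eq L1 L2 -> perm_eq (verts L1) (verts L2).
Proof. by move=> LL; apply/perm_flatten/perm_map. Qed.

Lemma verts_shift x L : verts (shift x L) = [seq y + x | y <- verts L].
Proof.
by elim: L => //= d L IH; rewrite [verts (_ :: _)]/verts /= -/(verts _) IH addrAC.
Qed.

Lemma cubeD p x s : cube (p + x) s = [seq y + x | y <- cube p s].
Proof.
by elim: s p => //= i s IH p; rewrite map_cat IH addrAC IH.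
Qed.

Lemma size_cube p s : size (cube p s) = (2 ^ size s)%N.
Proof. by elim: s p => //= i s IH p; rewrite size_cat !IH expnS mul2n addnn. Qed.

Lemma cube_rem p s i : i \in s -> perm_eq (cube p s) (cube p (i :: rem i s)).
Proof.
elim: s p => //= j s IH p; rewrite inE eq_sym.
have [->|_] := eqVneq j i; first by [].
move=> /= si; have /permP C1 := IH p si; have /permP C2 := IH (p + A j) si.
by apply/permP => a; rewrite !count_cat C1 C2 /= !count_cat (addrAC p) addnACA.
Qed.

Lemma perm_cube p s t : perm_eq s t -> perm_eq (cube p s) (cube p t).
Proof.
elim: s t p => [|i s IH] t p st.
  by move: (perm_size st); case: t {st}.
have it : i \in t by rewrite -(perm_mem st) mem_head.
rewrite perm_sym (permPl (cube_rem p it)) perm_sym.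
have sr : perm_eq s (rem i t).
  by rewrite -(perm_cons i) (permPl st) perm_to_rem.
by rewrite /= perm_cat ?IH.
Qed.

(** Since [x + x = 0], moving the base point to another vertex only exchanges opposite facets. *)
Lemma cube_base p x s : x \in cube p s -> perm_eq (cube x s) (cube p s).
Proof.
elim: s p x => [|i s IH] p x /=; first by rewrite inE => /eqP ->.
rewrite mem_cat; case/orP => [/IH xs|].
  by rewrite perm_cat // !cubeD perm_map.
rewrite cubeD => /mapP[y /IH yp ->].
by rewrite -addrA addVV addr0 perm_catC perm_cat // !cubeD perm_map.
Qed.

Lemma mem_cube_base p s : p \in cube p s.
Proof. by elim: s p => [|i s IH] p /=; rewrite ?inE // mem_cat IH. Qed.

Lemma tiling_perm p s t P P' D D' :
    perm_eq s t -> perm_eq P P' -> perm_eq D D' ->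
  tiling p s P D -> tiling p t P' D'.
Proof.
move=> st PP' DD' [L [vL dL]]; exists L.
have PL : perm_eq (P' ++ L) (P ++ L) by rewrite perm_cat2r perm_sym.
rewrite (permPl (perm_verts PL)) (permPl vL) perm_cube //; split=> //.
by rewrite (permPl (perm_map _ PL)) (permPl dL).
Qed.

Lemma tiling_forget p s P P' D : tiling p s (P' ++ P) D -> tiling p s P D.
Proof.
case=> L [vL dL]; exists (P' ++ L).
have PL : perm_eq (P ++ P' ++ L) ((P' ++ P) ++ L) by perm_count.
by rewrite (permPl (perm_verts PL)) (permPl (perm_map _ PL)).
Qed.

Lemma tiling_cons p s i P P' D D' :
    tiling p s P D -> tiling (p + A i) s P' D' ->
  tiling p (i :: s) (P ++ P') (D ++ D').
Proof.
move=> [L [vL dL]] [L' [vL' dL']]; exists (L ++ L').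
have PL : perm_eq ((P ++ P') ++ L ++ L') ((P ++ L) ++ (P' ++ L')) by perm_count.
rewrite (permPl (perm_verts PL)) (permPl (perm_map _ PL)).
by rewrite verts_cat map_cat /= !perm_cat.
Qed.

(* Translations of the cube carry any edge of direction i to any vertex. *)
Lemma tiling_pointed p s D i x :
  tiling p s [::] D -> i \in D -> x \in cube p s -> tiling p s [:: (x, i)] D.
Proof.
move=> [L [vL dL]] iD xs.
have /mapP[[y j] yL /= ij] : i \in [seq d.2 | d <- L] by rewrite (perm_mem dL).
have ys : y \in cube p s.
  rewrite -(perm_mem vL); apply/flattenP; exists [:: y; y + A j].
    by apply/mapP; exists (y, j).
  by rewrite mem_head.
have LE : perm_eq ((x, i) :: shift (x - y) (rem (y, j) L)) (shift (x - y) L).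
  rewrite perm_sym (permPl (perm_map _ (perm_to_rem yL))) /=.
  by rewrite addrC subrK ij.
exists (shift (x - y) (rem (y, j) L)).
rewrite (permPl (perm_verts LE)) (permPl (perm_map _ LE)); split; last first.
  by rewrite /shift -map_comp.
rewrite verts_shift (permPl (perm_map _ vL)) /=.
have yp := cube_base ys; have xp := cube_base xs.
apply: perm_trans xp.
have -> : cube x s = cube (y + (x - y)) s by rewrite addrC subrK.
by rewrite cubeD perm_map // perm_sym.
Qed.

(** Opposite sides of the square spanned by [i] and [j] at [x] cover the same four vertices in
    either direction. *)
Lemma tiling_swap p s i j x P D :
    tiling p s [:: (x, i), (x + A j, i) & P] [:: i, i & D] ->
  tiling p s [:: (x, j), (x + A i, j) & P] [:: j, j & D].
Proof.
move=> [L [vL dL]]; exists L; split; last by rewrite /= !perm_cons in dL *.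
rewrite -(permPr vL) /verts /= addVAC.
by apply/permP => a /=; lia.
Qed.

(* Doubling a matching along j: an edge of direction i in both copies can be
   traded for two edges of direction j. *)
Lemma tiling_double p s j E F G :
    tiling p s [::] F -> perm_eq F (E ++ G) ->
  tiling p (j :: s) [::] ((E ++ nseq (size G) j) ++ (E ++ nseq (size G) j)).
Proof.
move=> [L [vL dL]] FE; rewrite /= in vL dL.
have [L' LL' dL'] := perm_map_inv (perm_trans dL FE).
have [L1 [L2 [L'E d1 d2]]] : exists L1 L2,
    [/\ L' = L1 ++ L2, [seq d.2 | d <- L1] = E & [seq d.2 | d <- L2] = G].
  exists (take (size E) L'), (drop (size E) L').
  by rewrite cat_take_drop map_take map_drop dL' take_size_cat ?drop_size_cat.
pose S := flatten [seq [:: (d.1, j); (d.1 + A d.2, j)] | d <- L2].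
exists (L1 ++ shift (A j) L1 ++ S); split=> /=.
  have /permP vL12 : perm_eq (cube p s) (verts L1 ++ verts L2).
    by rewrite -verts_cat -L'E -(permPr (perm_verts LL')) perm_sym.
  have /permP vS : perm_eq (verts S) (verts L2 ++ [seq y + A j | y <- verts L2]).
    rewrite {}/S; elim: (L2) => //= d u /permP IH; apply/permP => a.
    rewrite /verts /= in IH *; rewrite IH !count_cat /= (addVAC d.1); lia.
  apply/permP => a; rewrite !verts_cat verts_shift cubeD !count_cat vS.
  rewrite !count_cat !count_map !vL12 !count_cat -!addnA; congr addn.
  exact: addnCA.
rewrite !map_cat /shift -map_comp /= d1.
have -> : [seq d.2 | d <- S] = nseq (size G + size G) j.
  rewrite -d2 size_map {}/S; elim: (L2) => //= d u ->.
  by rewrite addnS.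
perm_count.
Qed.

(** Each of the two facets across [i] is matched using one half of [E], doubled. *)
Lemma tiling_split p s i K E :
    (forall F q, {subset F <= s} -> size F = (2 ^ K)%N ->
       tiling q s [::] (F ++ F)) ->
    {subset E <= s} -> size E = (2 ^ K.+1)%N ->
  tiling p (i :: s) [::] (E ++ E).
Proof.
move=> IH Es sE; set E1 := take (2 ^ K) E; set E2 := drop (2 ^ K) E.
have EE : E = E1 ++ E2 by rewrite cat_take_drop.
have sE1 : size E1 = (2 ^ K)%N by rewrite size_takel // sE expnS; lia.
have sE2 : size E2 = (2 ^ K)%N by rewrite size_drop sE expnS; lia.
have D12 : perm_eq ((E1 ++ E1) ++ (E2 ++ E2)) (E ++ E) by rewrite EE; perm_count.
apply: (tiling_perm (perm_refl _) (perm_refl _) D12).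
rewrite -[[::]]/([::] ++ [::]); apply: tiling_cons; apply: IH => // x xE; apply: Es.
  exact: mem_take xE.
exact: mem_drop xE.
Qed.

(** Both facets across [j] are matched with one common direction [i], whose edges are placed above
    each other; swapping this square produces the two edges of direction [j]. *)
Lemma tiling_split_swap p s j K E :
    (forall F q, {subset F <= s} -> size F = (2 ^ K)%N ->
       tiling q s [::] (F ++ F)) ->
    {subset E <= s} -> (size E).+1 = (2 ^ K.+1)%N ->
  tiling p (j :: s) [::] ((j :: E) ++ (j :: E)).
Proof.
move=> IH Es sE; have k0 : (0 < 2 ^ K)%N by rewrite expn_gt0.
case: E => [|i E] /= in Es sE *; first by rewrite expnS in sE; lia.
(* The head [i] is given to both halves: the swap consumes two of the resulting additional
   copies. *)
set E1 := i :: take (2 ^ K).-1 E; set E2 := i :: drop (2 ^ K).-1 E.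
have sE1 : size E1 = (2 ^ K)%N by rewrite /= size_takel; move: sE; rewrite expnS; lia.
have sE2 : size E2 = (2 ^ K)%N by rewrite /= size_drop; move: sE; rewrite expnS; lia.
have T1 : tiling p s [:: (p, i)] (E1 ++ E1).
  apply: tiling_pointed; rewrite ?mem_cube_base ?mem_head //.
  apply: IH => // x; rewrite inE => /predU1P[->|/mem_take xE]; apply: Es.
    by rewrite mem_head.
  by rewrite inE xE orbT.
have T2 : tiling (p + A j) s [:: (p + A j, i)] (E2 ++ E2).
  apply: tiling_pointed; rewrite ?mem_cube_base ?mem_head //.
  apply: IH => // x; rewrite inE => /predU1P[->|/mem_drop xE]; apply: Es.
    by rewrite mem_head.
  by rewrite inE xE orbT.
have EE : E = take (2 ^ K).-1 E ++ drop (2 ^ K).-1 E by rewrite cat_take_drop.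
apply: (@tiling_forget _ _ _ [:: (p, j); (p + A i, j)]).
have DD : perm_eq [:: j, j & i :: E ++ i :: E] (j :: i :: E ++ [:: j, i & E]).
  by perm_count.
apply: (tiling_perm (perm_refl _) (perm_refl _) DD); apply: tiling_swap.
apply: tiling_perm (tiling_cons T1 T2); rewrite ?perm_refl //.
by rewrite [in X in perm_eq _ X]EE /E1 /E2; perm_count.
Qed.

(* The multiset E, with multiplicities rounded up to even numbers outside j and
   padded, is F ++ F; doubling F ++ F along j and trading the surplus against j
   realises E ++ E. *)
Lemma tiling_split_double p s j K E :
    (forall F q, {subset F <= s} -> size F = (2 ^ K)%N ->
       tiling q s [::] (F ++ F)) ->
    uniq (j :: s) -> s != [::] -> {subset E <= j :: s} -> size E = (2 ^ K.+1)%N ->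
    (\sum_(i <- s) odd (count_mem i E) <= count_mem j E)%N ->
  tiling p (j :: s) [::] (E ++ E).
Proof.
move=> IH /= /andP[js us] s0 Es sE tE.
have sumE : (count_mem j E + \sum_(i <- s) count_mem i E = 2 ^ K.+1)%N.
  by rewrite -sE -(sum_count_mem (s := j :: s)) ?big_cons //= js.
pose F0 := flatten [seq nseq (uphalf (count_mem i E)) i | i <- s].
(* Rounding up costs one per odd multiplicity in [s], and the hypothesis says that the copies of [j]
   pay for it. *)
have sF0 : (size F0 <= 2 ^ K)%N.
  rewrite size_flatten_nseq -(leq_pmul2l (ltn0Sn 1)) -expnS -sumE big_distrr /=.
  have -> : (\sum_(i <- s) 2 * uphalf (count_mem i E) =
             \sum_(i <- s) odd (count_mem i E) + \sum_(i <- s) count_mem i E)%N.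
    rewrite -big_split; apply: eq_bigr => i _ /=.
    by rewrite uphalf_half; have := odd_double_half (count_mem i E); lia.
  by rewrite leq_add2r.
have [i0 i0s] : exists i0, i0 \in s by case: (s) s0 => // i u _; exists i; rewrite mem_head.
pose F := F0 ++ nseq (2 ^ K - size F0) i0.
have sF : size F = (2 ^ K)%N by rewrite size_cat size_nseq subnKC.
have Fs : {subset F <= s}.
  move=> x; rewrite mem_cat => /orP[/flattenP[u /mapP[i si ->]]|]; last first.
    by rewrite mem_nseq => /andP[_ /eqP ->].
  by rewrite mem_nseq => /andP[_ /eqP ->].
have [|G FG] := @sub_count_split _ (filter (predC1 j) E) (F ++ F).
  move=> x; rewrite count_filter.
  have [->|xj] := eqVneq x j.
    by rewrite (eq_count (a2 := pred0)) ?count_pred0 // => y /=; case: eqP.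
  rewrite (eq_count (a2 := pred1 x)); last first.
    by move=> y /=; case: eqP => // ->; rewrite xj.
  rewrite !count_cat count_mem_flatten_nseq //.
  have [xs|xs] := boolP (x \in s).
    by have := odd_double_half (count_mem x E); rewrite uphalf_half; lia.
  suff /count_memPn -> : x \notin E by [].
  apply/negP => /Es.
  by rewrite inE (negPf xj) (negPf xs).
(* As [F ++ F] and [E] have equal size, the surplus [G] has exactly as many entries as [E] has
   copies of [j]. *)
have EE : perm_eq (filter (predC1 j) E ++ nseq (size G) j) E.
  have -> : nseq (size G) j = filter (pred1 j) E.
    have -> : size G = count_mem j E.
      have := perm_size FG; rewrite (size_cat F) sF size_cat size_filter.
      rewrite (eq_count (a2 := predC (pred1 j))) //.
      by have := count_predC (pred1 j) E; rewrite sE expnS; lia.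
    by rewrite -size_filter; apply/esym/all_pred1P/filter_all.
  by rewrite perm_catC; apply/permPl/perm_filterC.
have DD : perm_eq ((filter (predC1 j) E ++ nseq (size G) j) ++
                   (filter (predC1 j) E ++ nseq (size G) j)) (E ++ E).
  exact: perm_cat.
apply: (tiling_perm (perm_refl _) (perm_refl _) DD).
by apply: tiling_double FG; apply: IH.
Qed.

Theorem tiling_even K s : size s = K.+2 -> uniq s -> forall E p,
  {subset E <= s} -> size E = (2 ^ K)%N -> tiling p s [::] (E ++ E).
Proof.
elim: K s => [|K IH] s ss us E p Es sE.
  case: E sE Es => [|i [|]] //= _ Es.
  have si : i \in s by apply: Es; rewrite mem_head.
  have := perm_to_rem si; have := size_rem si; rewrite ss.
  case: (rem i s) => [|j [|]] // _ sij.
  have {}sij : perm_eq [:: j; i] s by rewrite perm_sym (permPl sij); perm_count.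
  apply: (tiling_perm sij (perm_refl _) (perm_refl _)).
  (* In dimension 2 the matching consists of two opposite sides of a square. *)
  by exists [:: (p, i); (p + A j, i)].
have IHr j : j \in s -> forall F q, {subset F <= rem j s} ->
    size F = (2 ^ K)%N -> tiling q (rem j s) [::] (F ++ F).
  by move=> js F q; apply: IH; rewrite ?rem_uniq // size_rem ?ss.
have suff_rem j D : j \in s -> tiling p (j :: rem j s) [::] D ->
    tiling p s [::] D.
  move=> js; apply: tiling_perm; rewrite ?perm_refl //.
  by rewrite perm_sym perm_to_rem.
have Erem j F : j \notin F -> {subset F <= s} -> {subset F <= rem j s}.
  move=> jF Fs x xF; rewrite mem_rem_uniq // inE Fs // andbT.
  by apply: contraNneq jF => <-.
have [/hasP[j js jE]|no0] := boolP (has (fun j => j \notin E) s).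
  apply: (suff_rem j) => //; apply: tiling_split (IHr _ js) _ sE; exact: Erem.
have [/hasP[j js /eqP jE]|no1] := boolP (has (fun j => count_mem j E == 1%N) s).
  have jinE : j \in E by rewrite -has_pred1 has_count jE.
  have ErE := perm_to_rem jinE.
  have ErE' : perm_eq ((j :: rem j E) ++ (j :: rem j E)) (E ++ E).
    by rewrite perm_sym perm_cat.
  apply: (tiling_perm (perm_refl _) (perm_refl _) ErE').
  apply: (suff_rem j) => //; apply: tiling_split_swap (IHr _ js) _ _.
    apply: Erem => [|x /mem_rem/Es //].
    by rewrite -has_pred1 has_count count_mem_rem jE eqxx.
  by rewrite -sE (perm_size ErE).
(* Every direction now occurs at least twice in [E], as [sum_odd_le_max] demands. *)
have s0 : s != [::] by case: (s) ss.
have [j js jmax] := exists_max_in (fun i => count_mem i E) s0.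
apply: (suff_rem j) => //.
have sr : perm_eq s (j :: rem j s) by exact: perm_to_rem.
have Esr : {subset E <= j :: rem j s} by move=> x /Es; rewrite (perm_mem sr).
have ur : uniq (j :: rem j s) by rewrite -(perm_uniq sr).
have r0 : rem j s != [::] by rewrite -size_eq0 size_rem // ss.
apply: (tiling_split_double p (IHr _ js) ur r0 Esr sE).
have ge2 i : i \in s -> (1 < count_mem i E)%N.
  move=> si; have := hasPn no0 _ si; have := hasPn no1 _ si.
  by rewrite negbK -has_pred1 has_count; case: (count_mem i E) => [|[|]].
apply: (sum_odd_le_max (k := K)).
- by rewrite size_rem // ss.
- by move=> i; rewrite -(perm_mem sr); apply: ge2.
- by move=> i /mem_rem/jmax.
by rewrite -sE -(sum_count_mem (s := j :: rem j s)) ?big_cons.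
Qed.

End Tilings.

(** * Matchings that contain the pairs prescribed by the centre path *)

Section Chains.

Local Open Scope ring_scope.

Variables (V : zmodType) (I : eqType) (A : I -> V).
Hypothesis addVV : forall x : V, x + x = 0.

Implicit Types (b c i j : I) (s t D E F G H R S X : seq I) (P : seq (V * I)).

Local Notation tiling := (tiling A).

Lemma tiling_grow s P F H K g :
    tiling 0 s P (F ++ F) -> size s = K.+2 -> uniq s ->
    {subset H <= s} -> size H = (2 ^ K)%N ->
  tiling 0 (g :: s) P ((F ++ H) ++ (F ++ H)).
Proof.
move=> TF ss us Hs sH; have TH := tiling_even A addVV ss us (0 + A g) Hs sH.
have DD : perm_eq ((F ++ F) ++ (H ++ H)) ((F ++ H) ++ (F ++ H)) by perm_count.
apply: tiling_perm (perm_refl _) _ DD (tiling_cons TF TH).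
by rewrite cats0.
Qed.

(** The new facet contains no prescribed pair yet, so its matching can be translated until it
    contains [(A g, c)]. *)
Lemma tiling_grow_edge s P F H K g c :
    tiling 0 s P (F ++ F) -> size s = K.+2 -> uniq s ->
    {subset H <= s} -> size H = (2 ^ K)%N -> c \in H ->
  tiling 0 (g :: s) ((A g, c) :: P) ((F ++ H) ++ (F ++ H)).
Proof.
move=> TF ss us Hs sH cH; have TH := tiling_even A addVV ss us (0 + A g) Hs sH.
have {TH}TH : tiling (0 + A g) s [:: (A g, c)] (H ++ H).
  by apply: tiling_pointed; rewrite // ?mem_cat ?cH // add0r mem_cube_base.
have DD : perm_eq ((F ++ F) ++ (H ++ H)) ((F ++ H) ++ (F ++ H)) by perm_count.
apply: tiling_perm (perm_refl _) _ DD (tiling_cons TF TH).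
by rewrite perm_catC.
Qed.

(** Each direction of [X] doubles the cube and takes from [G] as many entries as [F] already has. *)
Lemma tiling_grow_list X s P F G K :
    tiling 0 s P (F ++ F) -> size s = K.+2 -> size F = (2 ^ K)%N ->
    uniq (X ++ s) -> {subset G <= s} -> size (F ++ G) = (2 ^ (size X + K))%N ->
  tiling 0 (X ++ s) P ((F ++ G) ++ (F ++ G)).
Proof.
elim: X s F G K => [|g X IH] s F G K TF ss sF uXs Gs sFG.
  have /size0nil -> : size G = 0%N by move: sFG; rewrite size_cat sF add0n; lia.
  by rewrite cats0.
have uXs' : uniq (X ++ g :: s).
  by rewrite -cat_rcons -cats1 -catA -(perm_uniq (s1 := g :: X ++ s)) //; perm_count.
have Xs : perm_eq (X ++ g :: s) ((g :: X) ++ s) by perm_count.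
apply: (tiling_perm Xs (perm_refl _) (perm_refl _)).
have gX : (2 ^ K <= 2 ^ (size X + K))%N by rewrite leq_exp2l // leq_addl.
have sG : (2 ^ K <= size G)%N.
  by move: sFG; rewrite size_cat sF /= addSn expnS; lia.
have FG : F ++ G = (F ++ take (2 ^ K) G) ++ drop (2 ^ K) G.
  by rewrite -catA cat_take_drop.
rewrite FG; apply: (IH _ _ _ K.+1).
- apply: (tiling_grow g TF ss); rewrite ?size_takel //.
    by move: uXs'; rewrite cat_uniq => /and3P[_ _ /andP[]].
  by move=> x /mem_take/Gs.
- by rewrite /= ss.
- by rewrite size_cat sF size_takel // addnn -mul2n expnS.
- by [].
- by move=> x /mem_drop/Gs; rewrite inE orbC => ->.
by rewrite -FG sFG /= addSn addnS.
Qed.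

(* The subcube spanned by b :: s is tiled using part F of the directions of E
   lying in s; the directions equal to b are not used yet. *)
Definition chain E b s P : Prop := exists F G,
  [/\ perm_eq [seq i <- E | i \in s] (F ++ G), (size F).*2 = (2 ^ size s)%N &
      tiling 0 (b :: s) P (F ++ F)].

Lemma perm_filter_cons E b s : b \notin s ->
  perm_eq [seq i <- E | i \in b :: s]
    ([seq i <- E | i \in s] ++ [seq i <- E | i == b]).
Proof.
move=> bs; apply/permP => a; rewrite count_cat !count_filter.
rewrite -count_predUI [X in (_ + X)%N](eq_count (a2 := pred0)).
  rewrite count_pred0 addn0; apply: eq_count => x /=; rewrite inE.
  by case: (a x); rewrite //= orbC.
move=> x /=; apply/negP => /andP[/andP[_ xs] /andP[_ /eqP xb]].
by rewrite -xb xs in bs.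
Qed.

(** The new pair needs an unspent copy of its direction [c]: either [c] is [b], no copy of which is
    spent, or a further copy is supplied in [E']. *)
Lemma chain_step E E' b s P g c R :
    chain E b s P -> s != [::] -> uniq (b :: s) -> c \in b :: s ->
    perm_eq [seq i <- E' | i \in b :: s] ([seq i <- E | i \in s] ++ c :: R) ->
    (2 ^ size s <= size [seq i <- E' | i \in b :: s])%N ->
  chain E' g (b :: s) ((A g, c) :: P).
Proof.
move=> [F [G [EF sF TF]]] s0 us cs E'E sE'.
have [K sK] : exists K, size s = K.+1 by case: (s) s0 => // i u; exists (size u).
have {}sF : size F = (2 ^ K)%N.
  by move: sF; rewrite sK expnS -muln2 mulnC => /eqP; rewrite eqn_pmul2l // => /eqP.
have k0 : (0 < 2 ^ K)%N by rewrite expn_gt0.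
have E'F : perm_eq [seq i <- E' | i \in b :: s] (F ++ c :: (G ++ R)).
  rewrite (permPl E'E); apply: (perm_trans (y := (F ++ G) ++ c :: R)).
    by rewrite perm_cat2r.
  perm_count.
(* Together with [c], enough entries remain to match the new facet. *)
have sGR : ((2 ^ K).-1 <= size (G ++ R))%N.
  move: sE'; rewrite (perm_size E'F) size_cat sF /= sK expnS; lia.
set H := c :: take (2 ^ K).-1 (G ++ R).
have sH : size H = (2 ^ K)%N by rewrite /= size_takel //; lia.
have E'H : perm_eq [seq i <- E' | i \in b :: s]
             ((F ++ H) ++ drop (2 ^ K).-1 (G ++ R)).
  by rewrite (permPl E'F) -catA /= cat_take_drop.
exists (F ++ H), (drop (2 ^ K).-1 (G ++ R)); split=> //.
  by rewrite size_cat sF sH /= sK !expnS; lia.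
apply: (tiling_grow_edge (K := K)); rewrite ?mem_head //= ?sK // => x xH.
have : x \in [seq i <- E' | i \in b :: s] by rewrite (perm_mem E'H) !mem_cat xH orbT.
by rewrite mem_filter => /andP[].
Qed.

Lemma chain_next E b s P g :
    chain E b s P -> s != [::] -> uniq (b :: s) -> b \in E ->
    (2 ^ size s <= size [seq i <- E | i \in b :: s])%N ->
  chain E g (b :: s) ((A g, b) :: P).
Proof.
move=> C s0 us bE sE; have /andP[bs _] := us.
have bb : b \in [seq i <- E | i == b] by rewrite mem_filter eqxx.
apply: (chain_step (R := rem b [seq i <- E | i == b]) g C); rewrite ?mem_head //.
by rewrite (permPl (perm_filter_cons _ bs)) perm_cat2l perm_to_rem.
Qed.

(** This serves the turn to the second branch of the path, whose first pair has direction [j] again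
    although the copies of [j] may all be spent. *)
Lemma chain_extra E b s P g c :
    chain E b s P -> s != [::] -> uniq (b :: s) -> c \in s ->
    (2 ^ size s <= size [seq i <- E | i \in b :: s])%N ->
  chain (c :: E) g (b :: s) ((A g, c) :: P).
Proof.
move=> C s0 us cs sE; have /andP[bs _] := us.
have cbs : c \in b :: s by rewrite inE cs orbT.
apply: (chain_step (R := [seq i <- E | i == b]) g C); rewrite //= cbs.
  have /permP EE := perm_filter_cons E bs.
  by apply/permP => a /=; rewrite EE !count_cat /=; lia.
exact: leqW.
Qed.

(** The two ends of the pair of [y] are the label of [y] and that of the path edge joining it to its
    predecessor [x]. *)
Definition path_pairs b t : seq (V * I) := pairmap (fun x y => (A y, x)) b t.

(* Hall's condition for tiling the subcubes of the filtration one by one. *)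
Definition rich E j S : Prop := forall b s,
  uniq (b :: s) -> j \in b :: s -> {subset b :: s <= S} ->
  ((size s).+1 < size S)%N -> (2 ^ size s <= size [seq i <- E | i \in b :: s])%N.

Lemma chain_catrev t E b s P j S :
    chain E b s P -> rich E j S -> j \in s -> uniq (catrev t (b :: s)) ->
    {subset catrev t (b :: s) <= S} -> {subset S <= E} ->
  exists b' s', b' :: s' = catrev t (b :: s) /\
                chain E b' s' (catrev (path_pairs b t) P).
Proof.
elim: t b s P => [|g t IH] b s P C rE js ut tS SE /=; first by exists b, s.
have s0 : s != [::] by case: (s) js.
have ubs : uniq (b :: s).
  by move: ut; rewrite catrevE cat_uniq => /and3P[].
have sub : {subset b :: s <= S}.
  by move=> x xs; apply: tS; rewrite catrevE mem_cat xs orbT.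
apply: IH => //; last by rewrite inE js orbT.
apply: chain_next => //; first by apply/SE/sub; rewrite mem_head.
apply: rE => //; first by rewrite inE js orbT.
have := uniq_leq_size ut tS; rewrite catrevE size_cat size_rev /=; lia.
Qed.

Lemma rich_of_max E j S :
    uniq S -> {subset E <= S} -> (forall i, count_mem i E <= count_mem j E)%N ->
    (2 ^ (size S).-1 <= (size E).+1)%N ->
  rich E j S.
Proof.
move=> uS ES maxj sE b s us js sS ltS.
(* An added direction occurs at most as often as [j], which is already counted, so the number of
   entries at most doubles. *)
have grow t : uniq (t ++ b :: s) ->
    (size [seq i <- E | i \in t ++ b :: s] <=
       2 ^ size t * size [seq i <- E | i \in b :: s])%N.
  elim: t => [|x t IH]; first by rewrite mul1n.
  rewrite cat_cons => /andP[xt /IH{}IH]; rewrite -[x :: _]/(x :: (t ++ b :: s)).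
  rewrite (perm_size (perm_filter_cons _ xt)) size_cat [X in (_ + X)%N]size_filter.
  have xj : (count_mem x E <= size [seq i <- E | i \in t ++ b :: s])%N.
    apply: leq_trans (maxj x) _; rewrite size_filter; apply: sub_count => y /eqP ->.
    by rewrite mem_cat js orbT.
  by rewrite /= expnS -mulnA mul2n -addnn leq_add // (leq_trans xj).
set t := [seq i <- S | i \notin b :: s].
have utS : uniq (t ++ b :: s).
  rewrite cat_uniq filter_uniq // us andbT andTb; apply/hasPn => x xs.
  by rewrite /t /= mem_filter xs.
have tS : perm_eq (t ++ b :: s) S.
  apply: uniq_perm => // x; rewrite mem_cat mem_filter.
  by have [xs|] := boolP (x \in b :: s); rewrite ?orbT ?orbF //= sS.
have := grow t utS; rewrite (_ : [seq i <- E | _] = E); last first.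
  apply/all_filterP/allP => x /ES; by rewrite (perm_mem tS).
have sizeS : (size t + (size s).+1 = size S)%N by rewrite -(perm_size tS) size_cat.
(* Since [2 ^ size t] is at least 2, the unit missing from the bound on [size E] disappears in
   rounding. *)
have t0 : (0 < size t)%N by lia.
have SE : (size S).-1 = (size t + size s)%N by lia.
move: sE; rewrite SE expnD; move: (size t) t0 => [|k] // _; rewrite expnS.
move: (2 ^ k)%N (expn_gt0 2 k) (2 ^ size s)%N (size _) => u /= u0 v w; nia.
Qed.

(** The branch [b :: R] is processed first, then [S]; the copy of [j] put in front of [E] is kept
    for the first pair of [S]. *)
Lemma tiling_two_paths_cons j b R S E :
    uniq (j :: (b :: R) ++ S) -> {subset E <= j :: (b :: R) ++ S} ->
    {subset j :: (b :: R) ++ S <= E} ->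
    (forall i, count_mem i E <= count_mem j E)%N ->
    (2 ^ size ((b :: R) ++ S) <= (size E).+1)%N ->
  exists F G, [/\ perm_eq (j :: E) (F ++ G),
    (size F).*2 = (2 ^ size ((b :: R) ++ S))%N &
    tiling 0 (j :: (b :: R) ++ S)
      ((0, j) :: path_pairs j (b :: R) ++ path_pairs j S) (F ++ F)].
Proof.
move=> uT ET TE maxj sE; set T := j :: (b :: R) ++ S in uT ET TE *.
have rE : rich E j T by exact: rich_of_max.
have rjE : rich (j :: E) j T.
  move=> c s us js sT ltT /=; rewrite js; exact/leqW/rE.
have jb : uniq [:: b; j].
  by move: uT => /= /andP[]; rewrite !inE negb_or eq_sym => /andP[-> _] _.
(* The square spanned by [j] and [b] is matched by the first two prescribed pairs, both of direction
   [j]; half of their directions is one copy of [j]. *)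
have C0 : chain E b [:: j] [:: (A b, j); (0, j)].
  have jE : j \in [seq i <- E | i \in [:: j]].
    by rewrite mem_filter mem_head TE ?mem_head.
  exists [:: j], (rem j [seq i <- E | i \in [:: j]]); split=> //.
    exact: perm_to_rem.
  exists [::]; split=> //=; rewrite /verts /= !add0r; perm_count.
have pR : perm_eq (catrev R [:: b; j]) (j :: b :: R).
  rewrite catrevE; apply/permP => a; rewrite count_cat count_rev /=; lia.
have RT : {subset catrev R [:: b; j] <= T}.
  by move=> x; rewrite (perm_mem pR) /T -cat_cons mem_cat => ->.
have uR : uniq (catrev R [:: b; j]).
  by move: uT; rewrite (perm_uniq pR) /T -cat_cons cat_uniq => /andP[].
have [b1 [s1 [bs1 C1]]] := chain_catrev C0 rE (mem_head _ _) uR RT TE.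
suff [b2 [s2 [bs2 C2]]] : exists b2 s2, perm_eq (b2 :: s2) T /\
    chain (j :: E) b2 s2 (catrev (path_pairs j S)
      (catrev (path_pairs b R) [:: (A b, j); (0, j)])).
  have [F [G [EF sF TF]]] := C2.
  have /andP[b2s2 _] : uniq (b2 :: s2) by rewrite (perm_uniq bs2).
  (* The chain has not touched the copies of its last direction [b2]; they join the leftovers. *)
  exists F, (G ++ [seq i <- j :: E | i == b2]); split.
  - have EE : [seq i <- j :: E | i \in b2 :: s2] = j :: E.
      apply/all_filterP/allP => x; rewrite (perm_mem bs2) inE => /predU1P[->|/ET //].
      exact: mem_head.
    by rewrite -{1}EE (permPl (perm_filter_cons _ b2s2)) catA perm_cat2r.
  - by rewrite sF; congr expn; have := perm_size bs2; rewrite /=; lia.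
  apply: tiling_perm TF => //; rewrite !catrevE /=.
  by apply/permP => a; rewrite !(count_cat, count_rev) /= !count_cat /=; lia.
have us1 : uniq (b1 :: s1) by rewrite bs1.
have size1 : size s1 = (size R).+1.
  have := congr1 size bs1; rewrite catrevE size_cat size_rev /=; lia.
have js1 : j \in s1.
  case: (lastP s1) size1 bs1 => // u x _.
  rewrite catrevE -[[:: b; j]]/(rcons [:: b] j) -rcons_cat -rcons_cons.
  by case/rcons_inj => _ ->; rewrite mem_rcons mem_head.
have s10 : s1 != [::] by case: (s1) js1.
case ES: S => [|g u].
  exists b1, s1; split; first by rewrite bs1 (permPl pR) /T ES cats0.
  have [F [G [EF sF TF]]] := C1; exists F, (j :: G); split=> //.
  by rewrite /= js1 perm_sym -cat1s perm_catCA /= perm_cons perm_sym.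
have C2 : chain (j :: E) g (b1 :: s1)
    ((A g, j) :: catrev (path_pairs b R) [:: (A b, j); (0, j)]).
  apply: chain_extra => //; apply: rE => //; first by rewrite inE js1 orbT.
    by rewrite bs1.
  rewrite size1 /T ES /= size_cat /=; lia.
have pT : perm_eq (catrev u (g :: b1 :: s1)) T.
  rewrite bs1 /T ES !catrevE; apply/permP => a.
  by rewrite !(count_cat, count_rev) /= !(count_cat, count_rev) /=; lia.
have [||||b2 [s2 [bs2 C3]]] := chain_catrev (t := u) C2 rjE.
- by rewrite inE js1 orbT.
- by rewrite (perm_uniq pT).
- by move=> x; rewrite (perm_mem pT).
- by move=> x /TE xE; rewrite inE xE orbT.
by exists b2, s2; rewrite bs2.
Qed.

Lemma tiling_two_paths j R S E :
    R ++ S != [::] ->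
    uniq (j :: R ++ S) -> {subset E <= j :: R ++ S} ->
    {subset j :: R ++ S <= E} ->
    (forall i, count_mem i E <= count_mem j E)%N ->
    (2 ^ size (R ++ S) <= (size E).+1)%N ->
  exists F G, [/\ perm_eq (j :: E) (F ++ G),
    (size F).*2 = (2 ^ size (R ++ S))%N &
    tiling 0 (j :: R ++ S)
      ((0, j) :: path_pairs j R ++ path_pairs j S) (F ++ F)].
Proof.
case: R => [|b R] RS; last exact: tiling_two_paths_cons.
case: S RS => // b S _ uT ET TE maxj sE.
have := @tiling_two_paths_cons j b S [::] E; rewrite !cats0.
exact.
Qed.

(* X consists of the coordinates not used as labels of the centre path. *)
Theorem tiling_centre_path j R S X E :
    X != [::] -> uniq (X ++ j :: R ++ S) -> {subset E <= j :: R ++ S} ->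
    (R ++ S != [::] -> {subset j :: R ++ S <= E}) ->
    (forall i, count_mem i E <= count_mem j E)%N ->
    (size (j :: E)).*2 = (2 ^ size (X ++ R ++ S))%N ->
  tiling 0 (X ++ j :: R ++ S)
    ((0, j) :: path_pairs j R ++ path_pairs j S) ((j :: E) ++ (j :: E)).
Proof.
move=> X0 uXT ET TE maxj sE.
have uT : uniq (j :: R ++ S) by move: uXT; rewrite cat_uniq => /and3P[].
have sizeF s F K : size s = K.+1 -> (size F).*2 = (2 ^ size s)%N ->
    size F = (2 ^ K)%N.
  by move=> ->; rewrite expnS; lia.
have [RS0|RS] := eqVneq (R ++ S) [::].
  case: X X0 => // x X _ in uXT sE *.
  have [R0 S0] : R = [::] /\ S = [::] by case: (R) RS0.
  move: uXT sE ET; rewrite {}R0 {}S0 /= cats0 => uXT sE ET.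
  have Xs : perm_eq (X ++ [:: x; j]) (x :: X ++ [:: j]) by perm_count.
  apply: (tiling_perm Xs (perm_refl _) (perm_refl _)).
  apply: (@tiling_grow_list X [:: x; j] _ [:: j] E 0) => //=.
  - apply: (@tiling_forget _ _ _ _ _ [:: (0, j)] [:: (A x, j)]).
    by exists [::]; split=> //; rewrite /verts /= !add0r; perm_count.
  - by rewrite (perm_uniq Xs).
  - by move=> y /ET; rewrite !inE => ->; rewrite orbT.
  by move: sE; rewrite expnS addn0; lia.
have sE1 : (2 ^ size (R ++ S) <= (size E).+1)%N.
  case: X X0 => // x X _ in uXT sE *.
  move: sE; rewrite /= size_cat expnS expnD.
  have : (0 < 2 ^ size X)%N by rewrite expn_gt0.
  nia.
have [F [G [EF sF TF]]] := tiling_two_paths RS uT ET (TE RS) maxj sE1.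
have [K sK] : exists K, size (R ++ S) = K.+1.
  by case: (R ++ S) RS => // i u; exists (size u).
have EE : perm_eq ((F ++ G) ++ (F ++ G)) ((j :: E) ++ (j :: E)).
  by rewrite perm_sym perm_cat.
apply: (tiling_perm (perm_refl _) (perm_refl _) EE).
apply: (tiling_grow_list (K := K)) => //=; first by rewrite sK.
- exact: sizeF sK sF.
- move=> x xG; have : x \in j :: E by rewrite (perm_mem EF) mem_cat xG orbT.
  by rewrite inE => /predU1P[->|/ET//]; rewrite mem_head.
by rewrite -(perm_size EF); apply: (sizeF (X ++ R ++ S)); rewrite // size_cat sK addnS.
Qed.

End Chains.

(** * The row space over ['F_2] as a cube, and the vectors covered by the prescribed pairs *)

Section Labelling.

Local Open Scope ring_scope.

Lemma F2_0or1 (a : 'F_2) : a = 0 \/ a = 1.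
Proof. by case: a => [[|[|]]] // ?; [left | right]; apply: val_inj. Qed.

Lemma addF2 (N : nat) (x : 'rV['F_2]_N) : x + x = 0.
Proof.
by apply/rowP => i; rewrite !mxE; case: (F2_0or1 (x 0 i)) => ->; apply: val_inj.
Qed.

Lemma mem_cube_sum (N : nat) (I : eqType) (A : I -> 'rV['F_2]_N) (s : seq I)
    (a : I -> 'F_2) (p : 'rV['F_2]_N) :
  p + \sum_(i <- s) a i *: A i \in cube A p s.
Proof.
elim: s p => [|i s IH] p; first by rewrite big_nil addr0 mem_head.
rewrite big_cons /= mem_cat; case: (F2_0or1 (a i)) => ->.
  by rewrite scale0r add0r IH.
by rewrite scale1r addrA IH orbT.
Qed.

Definition unit_row (n i : nat) : 'rV['F_2]_n.+1 := delta_mx 0 (inord i).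

(** Every row is a sum of distinct unit rows, and equal sizes exclude repetitions. *)
Lemma perm_cube_enum (n : nat) (s : seq nat) : perm_eq s (iota 0 n.+1) ->
  perm_eq (cube (unit_row n) 0 s) (enum {: 'rV['F_2]_n.+1}).
Proof.
move=> ss; rewrite (permPl (perm_cube _ _ ss)).
have sub : {subset enum {: 'rV['F_2]_n.+1} <= cube (unit_row n) 0 (iota 0 n.+1)}.
  move=> x _; rewrite [x]row_sum_delta.
  have := mem_cube_sum (unit_row n) (iota 0 n.+1) (fun i => x 0 (inord i)) 0.
  rewrite add0r -[iota _ _]/(index_iota 0 n.+1) big_mkord.
  by under eq_bigr => i _ do rewrite /unit_row inord_val.
have sz : size (cube (unit_row n) 0 (iota 0 n.+1)) = size (enum {: 'rV['F_2]_n.+1}).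
  by rewrite size_cube size_iota -cardE card_mx card_Fp // mul1n.
have uc := leq_size_uniq (enum_uniq _) sub (eq_leq sz).
apply: uniq_perm => //; first exact: enum_uniq.
by have [_ eqs] := uniq_min_size (enum_uniq _) sub (eq_leq sz) => x; rewrite eqs.
Qed.

Lemma verts_split (V : zmodType) (I : eqType) (A : I -> V) (L : seq (V * I)) :
  perm_eq (verts A L)
    ([seq d.1 | d <- L] ++ [seq d.1 + A d.2 | d <- L]).
Proof.
elim: L => //= d L /permP IH; apply/permP => a.
have -> : verts A (d :: L) = [:: d.1, d.1 + A d.2 & verts A L] by [].
rewrite /= IH !count_cat /=; lia.
Qed.

Lemma path_pairs_iota (V : zmodType) (A : nat -> V) (j m : nat) :
  path_pairs A j (iota j.+1 m) = [seq (A i.+1, i) | i <- iota j m].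
Proof. by elim: m j => //= m IH j; rewrite -IH. Qed.

Lemma rev_iota0S (j : nat) : rev (iota 0 j.+1) = j :: rev (iota 0 j).
Proof. by rewrite -addn1 iotaD rev_cat. Qed.

Lemma path_pairs_rev_iota (V : zmodType) (A : nat -> V) (j : nat) :
  path_pairs A j (rev (iota 0 j)) = [seq (A i, i.+1) | i <- rev (iota 0 j)].
Proof. by elim: j => // j IH; rewrite rev_iota0S /= -IH. Qed.

(** The pair at 0 takes care of 0 and [A j]; every other pair covers a path label and the label of
    the path edge leading towards [j]. *)
Lemma perm_verts_centre (V : zmodType) (A : nat -> V) (j m : nat) :
  perm_eq
    (verts A ((0, j) :: path_pairs A j (iota j.+1 m) ++
                        path_pairs A j (rev (iota 0 j))))
    (0 :: [seq A i | i <- iota 0 (j + m).+1] ++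
          [seq A i + A i.+1 | i <- iota 0 (j + m)]).
Proof.
rewrite (permPl (verts_split _ _)) path_pairs_iota path_pairs_rev_iota.
rewrite -addnS !iotaD /= !map_cat /= ?map_cat -!map_comp !add0n add0r.
have -> : [seq ((fun d : V * nat => d.1) \o (fun i => (A i.+1, i))) i | i <- iota j m]
        = [seq A i | i <- iota j.+1 m].
  by rewrite -[j.+1]add1n iotaDl -map_comp.
have -> : [seq ((fun d : V * nat => d.1 + A d.2) \o (fun i => (A i.+1, i))) i
            | i <- iota j m] = [seq A i + A i.+1 | i <- iota j m].
  by apply: eq_map => i; rewrite /= addrC.
have -> : [seq ((fun d : V * nat => d.1) \o (fun i => (A i, i.+1))) i
            | i <- rev (iota 0 j)] = rev [seq A i | i <- iota 0 j].
  by rewrite -map_rev.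
have -> : [seq ((fun d : V * nat => d.1 + A d.2) \o (fun i => (A i, i.+1))) i
            | i <- rev (iota 0 j)] = rev [seq A i + A i.+1 | i <- iota 0 j].
  by rewrite -map_rev.
by apply/permP => a; rewrite /= !(count_cat, count_rev) /= !(count_cat, count_rev) /=; lia.
Qed.

End Labelling.

(** * From an enumeration of all vectors to a set-sequential labelling *)

Section GraphLabelling.

Variables (T : finType) (e : rel T).

Lemma edge_label2 (m : nat) (f : T -> 'rV['F_2]_m) (x y : T) :
  x != y -> edge_label f [set x; y] = (f x + f y)%R.
Proof.
by move=> xy; rewrite /edge_label big_setU1 ?inE //= big_set1.
Qed.

Lemma set_sequential_of_perm (m : nat) (f : T -> 'rV['F_2]_m)
    (vs : seq T) (es : seq {set T}) :
    0 < m -> perm_eq vs (enum T) -> es =i edges e ->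
    perm_eq (0%R :: map f vs ++ map (edge_label f) es)
      (enum {: 'rV['F_2]_m}) ->
  set_sequential e.
Proof.
move=> m0 vsT esE pf; exists m, f.
have := enum_uniq {: 'rV['F_2]_m}; rewrite -(perm_uniq pf) /= mem_cat negb_or.
rewrite cat_uniq => /andP[/andP[f0 _] /and3P[uf _ /map_uniq ues]].
have memv x : x \in vs by rewrite (perm_mem vsT) mem_enum.
have fI : injective f.
  by apply/injectiveP; rewrite /injectiveb /dinjectiveb -(perm_uniq (perm_map f vsT)).
split=> // [x|v v0].
  by apply: contraNneq f0 => <-; rewrite map_f.
have : count_mem v (enum {: 'rV['F_2]_m}) = 1.
  by rewrite count_uniq_mem ?enum_uniq // mem_enum.
rewrite -(permP pf) /= eq_sym (negPf v0) add0n count_cat !count_map => c1.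
apply: etrans c1; congr (_ + _).
  rewrite cardE -size_filter; apply: perm_size; apply: uniq_perm.
  - exact: enum_uniq.
  - by rewrite filter_uniq // (perm_uniq vsT) enum_uniq.
  by move=> x; rewrite mem_enum !inE mem_filter memv andbT.
rewrite cardE -size_filter; apply: perm_size; apply: uniq_perm.
- exact: enum_uniq.
- exact: filter_uniq.
by move=> E; rewrite mem_enum mem_filter esE [LHS]in_set andbC.
Qed.

End GraphLabelling.

(** * Labelling a graph that consists of a path with leaves attached *)

Section Spine.

Variables (T : finType) (e : rel T) (x0 : T) (sp : seq T) (par : T -> nat).
Hypothesis e_sym : symmetric e.
Hypothesis sp_uniq : uniq sp.
Hypothesis sp_adj : forall i k, i < size sp -> k < size sp ->
  e (nth x0 sp i) (nth x0 sp k) = (i.+1 == k) || (k.+1 == i).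
Hypothesis par_lt : forall u, u \notin sp -> par u < size sp.
Hypothesis leaf_adj : forall u i, u \notin sp -> i < size sp ->
  e (nth x0 sp i) u = (par u == i).
Hypothesis leaves_nonadj : forall u w, u \notin sp -> w \notin sp ->
  e u w = false.

Local Notation q := (size sp).
Local Notation v := (nth x0 sp).

Definition leaves : seq T := [seq u <- enum T | u \notin sp].

Lemma mem_leaves u : (u \in leaves) = (u \notin sp).
Proof. by rewrite mem_filter mem_enum andbT. Qed.

Lemma perm_spine_leaves : perm_eq (sp ++ leaves) (enum T).
Proof.
apply: uniq_perm; rewrite ?enum_uniq //.
  rewrite cat_uniq sp_uniq filter_uniq ?enum_uniq // andbT.
  by apply/hasPn => u; rewrite mem_leaves.
by move=> u; rewrite mem_cat mem_leaves mem_enum orbN.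
Qed.

Lemma count_mem_iota0 y m : count_mem y (iota 0 m) = (y < m).
Proof. by rewrite count_uniq_mem ?iota_uniq // mem_iota. Qed.

Lemma degree_spine i : i < q ->
  degree e (v i) = (0 < i) + (i.+1 < q) + count_mem i (map par leaves).
Proof.
move=> iq; have -> : degree e (v i) = count (e (v i)) (enum T).
  rewrite /degree cardE -size_filter; apply: perm_size.
  apply: uniq_perm => [||u]; [exact: enum_uniq | exact/filter_uniq/enum_uniq |].
  by rewrite mem_enum inE mem_filter mem_enum andbT.
rewrite -(permP perm_spine_leaves) count_cat.
have -> : count_mem i (map par leaves) = count (e (v i)) leaves.
  rewrite count_map; apply: eq_in_count => u.
  by rewrite mem_leaves => us; rewrite leaf_adj.
congr addn.
have -> : count (e (v i)) sp = count (fun k => (i.+1 == k) || (k.+1 == i)) (iota 0 q).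
  rewrite -[X in count _ X = _](mkseq_nth x0) /mkseq count_map; apply: eq_in_count => k.
  by rewrite mem_iota => kq; rewrite /= sp_adj.
rewrite addnC -count_mem_iota0.
have -> : (0 < i) = count (fun k => k.+1 == i) (iota 0 q) :> nat.
  case: i iq => [|i] iq; first by rewrite (eq_count (a2 := pred0)) ?count_pred0.
  by rewrite -[RHS]/(count_mem i (iota 0 q)) count_mem_iota0 (ltnW iq).
rewrite -count_predUI [X in _ + X](eq_count (a2 := pred0)) ?count_pred0 ?addn0.
  by apply: eq_count => k /=; rewrite eq_sym.
by move=> k /=; apply/negP => /andP[/eqP -> /eqP]; lia.
Qed.

Definition half_directions : seq nat :=
  flatten [seq nseq (degree e (v i)).-1./2 i | i <- iota 0 q].

Lemma count_half_directions i :
  count_mem i half_directions = (i < q) * (degree e (v i)).-1./2.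
Proof. by rewrite count_mem_flatten_nseq ?iota_uniq // mem_iota. Qed.

Hypothesis deg_odd : forall x, odd (degree e x).

(** Direction [i] other than [j] is needed [degree - 1] times, the path edge towards [j] not being
    counted; [j] is needed [degree + 1] times because of the pair at 0. Odd degrees make both
    even. *)
Lemma perm_directions j m : q = (j + m).+1 ->
  perm_eq ((j :: half_directions) ++ (j :: half_directions))
    (j :: iota j m ++ rev (iota 1 j) ++ map par leaves).
Proof.
move=> qE; apply/allP => i _; apply/eqP => /=.
rewrite !count_cat /= count_half_directions count_rev.
rewrite !(count_uniq_mem _ (iota_uniq _ _)) !mem_iota.
have [iq|qi] := ltnP i q; last first.
  have /count_memPn -> : i \notin map par leaves.
    by apply/mapP => -[u]; rewrite mem_leaves => /par_lt + iE; lia.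
  rewrite mul0n; lia.
have := degree_spine iq; have := odd_double_half (degree e (v i)).-1.
have := deg_odd (v i); case: (degree e (v i)) => // d /=.
move: (count_mem i _) => r; rewrite mul1n => /negPf ->.
case: (eqVneq j i) => /=; lia.
Qed.

Definition spine_edges : seq {set T} :=
  [seq [set v i; v i.+1] | i <- iota 0 q.-1] ++
  [seq [set u; v (par u)] | u <- leaves].

Lemma mem_spine_edges : spine_edges =i edges e.
Proof.
move=> E; apply/idP/idP.
  rewrite mem_cat => /orP[] /mapP[].
    move=> i; rewrite mem_iota => iq ->; rewrite inE; apply/existsP; exists (v i).
    by apply/existsP; exists (v i.+1); rewrite sp_adj ?eqxx //; lia.
  move=> u; rewrite mem_leaves => us ->; rewrite inE; apply/existsP; exists u.
  by apply/existsP; exists (v (par u)); rewrite e_sym leaf_adj ?eqxx ?par_lt.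
rewrite inE => /existsP[x /existsP[y /andP[exy /eqP ->]]].
have leafE u w : u \notin sp -> w \in sp -> e w u -> [set u; w] \in spine_edges.
  move=> us ws; rewrite -(nth_index x0 ws) leaf_adj ?index_mem // => /eqP pu.
  rewrite mem_cat -pu; apply/orP; right; apply/mapP; exists u => //.
  by rewrite mem_leaves.
have [xs|xs] := boolP (x \in sp); have [ys|ys] := boolP (y \in sp).
- move: exy; rewrite -(nth_index x0 xs) -(nth_index x0 ys).
  have xi : index x sp < q by rewrite index_mem.
  have yi : index y sp < q by rewrite index_mem.
  rewrite sp_adj // mem_cat => /orP[] /eqP E1; apply/orP; left; apply/mapP.
    by exists (index x sp); rewrite ?E1 // mem_iota; clear -E1 yi; lia.
  by exists (index y sp); rewrite ?E1 1?setUC // mem_iota; clear -E1 xi; lia.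
- by rewrite setUC leafE.
- by rewrite leafE // e_sym.
by rewrite leaves_nonadj in exy.
Qed.

Lemma v_inj i k : i < q -> k < q -> (v i == v k) = (i == k).
Proof. by move=> iq kq; rewrite nth_uniq. Qed.

Lemma spine_set_sequential n :
    0 < q -> q <= n -> #|T| = 2 ^ n ->
    (1 < q -> forall i, i < q -> 1 < degree e (v i)) ->
  set_sequential e.
Proof.
move=> q0 qn cardT deg2.
have [j jq jmax] : exists2 j, j < q &
    forall i, i < q -> degree e (v i) <= degree e (v j).
  have io : iota 0 q != [::] by rewrite -size_eq0 size_iota -lt0n.
  have [j jq jmax] := exists_max_in (fun i => degree e (v i)) io.
  exists j; first by rewrite mem_iota in jq.
  by move=> i iq; apply: jmax; rewrite mem_iota.
have [m qE] : exists m, q = (j + m).+1 by exists (q - j.+1); lia.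
pose A := unit_row n.
(* There are as many pairs as vertices: [j + m + 1] prescribed ones and one for each leaf. *)
have sizeE : (size (j :: half_directions)).*2 = 2 ^ n.
  rewrite -cardT cardE -(perm_size perm_spine_leaves) -addnn -size_cat.
  rewrite (perm_size (perm_directions qE)) /= !size_cat size_rev !size_iota size_map.
  by rewrite qE; lia.
have pI : perm_eq (iota q (n.+1 - q) ++ j :: iota j.+1 m ++ rev (iota 0 j))
            (iota 0 n.+1).
  have -> : iota 0 n.+1 = iota 0 q ++ iota q (n.+1 - q).
    by rewrite -{1}(subnKC (leqW qn)) iotaD.
  have -> : iota 0 q = iota 0 j ++ j :: iota j.+1 m by rewrite qE -addnS iotaD.
  apply/permP => a; rewrite !(count_cat, count_rev) /= !(count_cat, count_rev) /=.
  lia.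
have := @tiling_centre_path _ _ A (@addF2 n.+1) j (iota j.+1 m) (rev (iota 0 j))
   (iota q (n.+1 - q)) half_directions.
case.
- by rewrite -size_eq0 size_iota; lia.
- by rewrite (perm_uniq pI) iota_uniq.
- move=> i; rewrite -has_pred1 has_count count_half_directions.
  case: ltnP => // iq _.
  rewrite !(inE, mem_cat, mem_rev, mem_iota); lia.
(* An odd degree above 1 is at least 3, so each path direction occurs in [half_directions]. *)
- move=> RS i iR; rewrite -has_pred1 has_count count_half_directions.
  have iq : i < q.
    move: iR; rewrite !(inE, mem_cat, mem_rev, mem_iota); lia.
  have q1 : 1 < q.
    by move: RS; rewrite -size_eq0 size_cat size_rev !size_iota; lia.
  rewrite iq mul1n half_gt0; have := deg2 q1 _ iq; have := deg_odd (v i).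
  by case: degree => [|[|[|]]].
- move=> i; rewrite !count_half_directions jq mul1n.
  by case: ltnP => // /jmax; rewrite mul1n => ij; apply: half_leq; lia.
- rewrite sizeE; congr expn; rewrite !size_cat size_rev !size_iota; lia.
move=> L [vL dL]; set P := (_, j) :: _ in vL dL.
have dP : map snd P = j :: iota j m ++ rev (iota 1 j).
  rewrite /P path_pairs_iota path_pairs_rev_iota /= map_cat -!map_comp map_id.
  by rewrite -[iota 1 j]/(iota (1 + 0) j) iotaDl map_rev.
(* Cancelling the prescribed pairs leaves one direction for each leaf, namely its parent. *)
have {}dL : perm_eq [seq d.2 | d <- L] (map par leaves).
  rewrite -(perm_cat2l (map snd P)) -map_cat (permPl dL).
  by rewrite (permPl (perm_directions qE)) dP /= -catA.
have [L' LL' dL'] := perm_map_inv dL.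
(* A leaf gets the first end of its pair; the second end, which differs by the label of the parent,
   is then the label of its edge. *)
pose f u := if u \in sp then A (index u sp)
            else (nth (0%R, 0) L' (index u leaves)).1.
have sL' : size L' = size leaves by have := congr1 size dL'; rewrite !size_map.
have f_leaves : map f leaves = [seq d.1 | d <- L'].
  apply: (@eq_from_nth _ 0%R); rewrite !size_map ?sL' // => i il.
  rewrite (nth_map x0) // (nth_map (0%R, 0)) ?sL' // /f.
  have := mem_nth x0 il; rewrite mem_leaves => /negPf ->.
  by rewrite index_uniq // filter_uniq ?enum_uniq.
have f_v i : i < q -> f (v i) = A i.
  by move=> iq; rewrite /f mem_nth // index_uniq.
apply: (@set_sequential_of_perm _ _ n.+1 f _ _ _ perm_spine_leaves mem_spine_edges) => //.
rewrite map_cat map_cat f_leaves.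
have -> : map f sp = [seq A i | i <- iota 0 q].
  rewrite -[X in map f X](mkseq_nth x0) -map_comp; apply/eq_in_map => i.
  by rewrite mem_iota => iq; rewrite /= f_v.
have -> : [seq edge_label f E | E <- [seq [set v i; v i.+1] | i <- iota 0 q.-1]]
        = [seq (A i + A i.+1)%R | i <- iota 0 q.-1].
  rewrite -map_comp; apply/eq_in_map => i; rewrite mem_iota => iq /=.
  by rewrite edge_label2 ?f_v ?v_inj //; lia.
have -> : [seq edge_label f E | E <- [seq [set u; v (par u)] | u <- leaves]]
        = [seq (d.1 + A d.2)%R | d <- L'].
  rewrite -map_comp; apply: (@eq_from_nth _ 0%R); rewrite !size_map ?sL' // => i il.
  rewrite (nth_map x0) // [RHS](nth_map (0%R, 0)) ?sL' //=.
  have us : nth x0 leaves i \notin sp by rewrite -mem_leaves mem_nth.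
  have fu : f (nth x0 leaves i) = (nth (0%R, 0) L' i).1.
    by rewrite -(nth_map x0 0%R f il) f_leaves (nth_map (0%R, 0)) ?sL'.
  have pu : par (nth x0 leaves i) = (nth (0%R, 0) L' i).2.
    by rewrite -(nth_map x0 0 par il) -dL' (nth_map (0%R, 0)) ?sL'.
  have vs : v (par (nth x0 leaves i)) \in sp by rewrite mem_nth ?par_lt.
  rewrite edge_label2 ?f_v ?par_lt ?fu ?pu //.
  by apply: contraNneq us => uv; rewrite uv -pu.
have /permP pP := perm_verts_centre A j m.
have /permP pL := verts_split A L'.
apply: perm_trans (perm_cube_enum pI); rewrite -(permPr vL).
have {}LL' : perm_eq (P ++ L) (P ++ L') by rewrite perm_cat2l.
rewrite (permPr (perm_verts A LL')) verts_cat.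
apply/permP => a; rewrite count_cat pP pL /= !count_cat qE /= -!addnA.
do 3!congr addn; exact: addnCA.
Qed.

End Spine.

(** * Structure of caterpillars: a trimmed dominating path, its leaves, and the diameter *)

Section Caterpillar.

Variables (T : finType) (e : rel T).
Hypothesis e_sym : symmetric e.
Hypothesis e_irr : irreflexive e.

Definition dominating_path (s : seq T) : Prop :=
  [/\ s != [::], sorted e s, uniq s &
      forall u, u \in s \/ exists2 w, w \in s & e u w].

Lemma gdist_le1 u w : connect e u w -> gdist e u w <= 1 -> u = w \/ e u w.
Proof.
case/gdist_walk => p [up <- <-].
by case: p up => [|y [|]] //=; [left | rewrite andbT; right].
Qed.

Lemma caterpillar_dominating_path :
  is_caterpillar e -> exists s, dominating_path s.
Proof.
move=> [[[_ conn] _] [x [p [xp up dom]]]]; exists (x :: p); split=> // u.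
by have [w wp /(gdist_le1 (conn _ _))[->|euw]] := dom u; [left | right; exists w].
Qed.

Lemma dominating_path_rev s : dominating_path s -> dominating_path (rev s).
Proof.
case=> s0 ss us dom; split; rewrite ?rev_uniq ?rev_sorted //.
- by rewrite -size_eq0 size_rev size_eq0.
- by rewrite (eq_sorted (e' := e)) // => x y; rewrite e_sym.
by move=> u; have [us'|[w ws uw]] := dom u; [left | right; exists w]; rewrite ?mem_rev.
Qed.

(** The only neighbour of [x] is [y], so [x] dominates nothing beyond itself and [y]. *)
Lemma dominating_path_behead x y s : degree e x <= 1 ->
  dominating_path [:: x, y & s] -> dominating_path (y :: s).
Proof.
move=> dx [_ /= /andP[exy ys] /andP[_ us] dom]; split=> // u.
have only z : e x z -> z = y.
  move=> exz; apply/eqP; apply: contraLR dx => zy; rewrite -ltnNge.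
  by apply/card_gt1P; exists z, y; rewrite !inE exz exy.
case: (dom u) => [|[w]]; rewrite inE => /predU1P[->|ws].
- by right; exists y; rewrite ?mem_head.
- by left.
- by rewrite e_sym => /only ->; left; rewrite mem_head.
by right; exists w.
Qed.

(** Ends of degree at most 1 are removed one by one, the far end after reversing the path. *)
Lemma dominating_path_shrink s : dominating_path s ->
  exists s', dominating_path s' /\ (1 < size s' ->
    forall x0, 1 < degree e (nth x0 s' 0) /\ 1 < degree e (nth x0 s' (size s').-1)).
Proof.
have [m] := ubnP (size s); elim: m s => // m IH s sm ds.
have [s1|s1] := leqP (size s) 1; first by exists s; split=> //; rewrite ltnNge s1.
case: s => [|x [|y s]] // in sm ds s1 *.
have [dx|dx] := leqP (degree e x) 1.
  by apply: IH (dominating_path_behead dx ds); move: sm => /=; lia.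
have dr := dominating_path_rev ds.
case E: (rev [:: x, y & s]) => [|z [|w r]] in dr;
  try by move/(congr1 size): E; rewrite size_rev.
have sE : (size r).+2 = (size s).+2 by rewrite -[RHS](size_rev [:: x, y & s]) E.
have [dz|dz] := leqP (degree e z) 1.
  by apply: IH (dominating_path_behead dz dr); move: sm => /=; lia.
exists [:: x, y & s]; split=> // _ x0; split=> //.
by rewrite nth_last -(revK [:: x, y & s]) E rev_cons last_rcons.
Qed.

Hypothesis e_acyclic : acyclic e.

Lemma acyclic_path x p :
  path e x p -> uniq (x :: p) -> e (last x p) x -> size p <= 1.
Proof.
move=> xp up ex; have : ucycle e (x :: p).
  by rewrite /ucycle /ucycleb up andbT /= rcons_path xp.
exact: e_acyclic.
Qed.

Variable s : seq T.
Hypothesis ds : dominating_path s.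
Variable x0 : T.

Local Notation v := (nth x0 s).

Lemma subpath i k : i <= k < size s -> exists p,
  [/\ path e (v i) p, last (v i) p = v k, uniq (v i :: p), size p = k - i &
      {subset v i :: p <= s}].
Proof.
case: ds => _ ss us _ /andP[ik ks]; have is_ : i < size s by exact: leq_ltn_trans ks.
pose p := take (k - i) (drop i.+1 s).
have pE : v i :: p = take (k - i).+1 (drop i s) by rewrite (drop_nth x0 is_).
have sp : size p = k - i by rewrite size_takel // size_drop; lia.
exists p; split=> //.
- have := take_sorted (k - i).+1 (drop_sorted i ss); by rewrite -pE.
- rewrite (last_nth x0) pE sp nth_take // nth_drop subnKC //.
- by rewrite pE take_uniq // drop_uniq.
by rewrite pE => x /mem_take/mem_drop.
Qed.

(** A chord would close a subpath to a cycle. *)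
Lemma spine_adjacent i k : i < size s -> k < size s ->
  e (v i) (v k) = (i.+1 == k) || (k.+1 == i).
Proof.
have [_ /(sortedP x0) ss _ _] := ds.
have lt_adj a b : a < b -> b < size s -> e (v a) (v b) = (a.+1 == b).
  move=> ab bs; apply/idP/eqP => [eab|<-]; last by apply: ss; lia.
  have [|p [vp lp up sp _]] := @subpath a b; first by rewrite ltnW.
  have := acyclic_path vp up; rewrite lp e_sym sp => /(_ eab); lia.
move=> iq kq; have [ik|ki|->] := ltngtP i k.
- rewrite lt_adj //; lia.
- rewrite e_sym lt_adj //; lia.
rewrite e_irr; lia.
Qed.

Lemma leaf_unique_neighbour u i k : u \notin s -> i < size s -> k < size s ->
  e u (v i) -> e u (v k) -> i = k.
Proof.
move=> us; wlog ik : i k / i <= k.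
  move=> W iq kq ui uk; have [ik|ki] := leqP i k; first exact: W.
  by apply/esym/W => //; exact: ltnW.
move=> iq kq ui uk; have [|p [vp lp up sp ps]] := @subpath i k; first by rewrite ik.
have uu : uniq (u :: v i :: p).
  by rewrite cons_uniq up andbT; apply: contra us => /ps.
have : size (v i :: p) <= 1.
  by apply: (@acyclic_path u) => //=; rewrite ?ui ?vp ?lp // e_sym.
by rewrite /= sp; lia.
Qed.

(** An edge between two leaves would close a cycle through the part of the path between their
    neighbours. *)
Lemma leaves_nonadjacent u w : u \notin s -> w \notin s -> e u w = false.
Proof.
move=> us ws; apply/negP => uw; have [_ _ _ dom] := ds.
have [i iq ui] : exists2 i, i < size s & e u (v i).
  have [|[y ys uy]] := dom u; first by rewrite (negPf us).
  by exists (index y s); rewrite ?index_mem // nth_index.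
have [k kq wk] : exists2 k, k < size s & e w (v k).
  have [|[y ys wy]] := dom w; first by rewrite (negPf ws).
  by exists (index y s); rewrite ?index_mem // nth_index.
wlog ik : u w us ws uw i k iq ui kq wk / i <= k.
  move=> W; have [ik|ki] := leqP i k; first exact: (W u w us ws uw i k).
  by apply: (W w u ws us _ k i) => //; [rewrite e_sym | exact: ltnW].
have [|p [vp lp up sp ps]] := @subpath i k; first by rewrite ik.
have wu : w != u by apply: contraTneq uw => ->; rewrite e_irr.
have uwu : uniq [:: w, u, v i & p].
  rewrite cons_uniq (cons_uniq u) up andbT inE negb_or wu; apply/andP.
  by split; [apply: contra ws => /ps | apply: contra us => /ps].
have : size [:: u, v i & p] <= 1 by
  apply: (@acyclic_path w) => //=; rewrite ?ui ?vp ?lp e_sym ?uw.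
by [].
Qed.

Definition parent u : nat := find (e u) s.

Lemma parent_lt u : u \notin s -> parent u < size s.
Proof.
move=> us; rewrite -has_find; have [_ _ _ dom] := ds.
by have [|[y ys uy]] := dom u; [rewrite (negPf us) | apply/hasP; exists y].
Qed.

Lemma adj_parent u i : u \notin s -> i < size s -> e (v i) u = (parent u == i).
Proof.
move=> us iq; have ups := parent_lt us.
have upar : e u (v (parent u)) by apply: nth_find; rewrite has_find.
apply/idP/eqP => [iu|<-]; last by rewrite e_sym.
by apply: (leaf_unique_neighbour us) => //; rewrite e_sym.
Qed.

(** An end of the path has a single neighbour on it, so any further neighbour is a leaf. *)
Lemma leaf_of_end i : 1 < size s -> i < size s -> (i == 0) || (i.+1 == size s) ->
  1 < degree e (v i) -> exists2 u, u \notin s & parent u = i.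
Proof.
have [_ _ us _] := ds; move=> s1 iq iend.
rewrite (degree_spine us spine_adjacent adj_parent) // => di.
have : i \in map parent (leaves s).
  by rewrite -has_pred1 has_count; move: di; case/orP: iend => /eqP; lia.
by case/mapP => u; rewrite mem_leaves => uS ->; exists u.
Qed.

(* The potential [H] changes by at most one along an edge and rises from 0 to
   q + 1 between leaves at the two ends of the path. *)
Lemma size_dominating_path :
    connected_graph e -> 1 < size s -> 1 < degree e (v 0) ->
    1 < degree e (v (size s).-1) ->
  size s < diameter e.
Proof.
move=> [_ conn] s1 d0 d1; set q := size s; have [_ _ us _] := ds.
have [y ys py] : exists2 u, u \notin s & parent u = 0 by apply: leaf_of_end => //; lia.
have [z zs pz] : exists2 u, u \notin s & parent u = q.-1.
  by apply: leaf_of_end => //; rewrite /q; lia.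
(* [h] is the position on the path, taken at the parent for a leaf; [H] raises it by one to make
   room for [y] below and [z] above. *)
pose h u := if u \in s then index u s else parent u.
pose H u := if u == y then 0 else if u == z then q.+1 else (h u).+1.
have hq u : h u < q.
  by rewrite /h; case: ifPn => [|/parent_lt //]; rewrite index_mem.
have h_leaf a b : e a b -> a \notin s -> b \in s /\ h a = h b.
  move=> ab as_; have [bs|bs] := boolP (b \in s); last first.
    by rewrite leaves_nonadjacent in ab.
  split=> //; rewrite /h (negPf as_) bs; apply/eqP.
  by rewrite -adj_parent ?index_mem // nth_index // e_sym.
have h_step a b : e a b -> h b <= (h a).+1.
  move=> ab; have [as_|/(h_leaf _ _ ab)[_ ->]//] := boolP (a \in s).
  have [bs|] := boolP (b \in s); last first.
    by rewrite e_sym in ab; case/(h_leaf _ _ ab) => _ ->.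
  move: ab; rewrite /h as_ bs -{1}(nth_index x0 as_) -{1}(nth_index x0 bs).
  by rewrite spine_adjacent ?index_mem //; lia.
have H_step a b : e a b -> H b <= (H a).+1.
  move=> ab; rewrite /H; have hab := h_step _ _ ab.
  have [//|_] := eqVneq b y.
  have [ay|_] := eqVneq a y.
    rewrite ay in ab; have [bs hE] := h_leaf _ _ ab ys.
    have [bz|_] := eqVneq b z; first by rewrite bz (negPf zs) in bs.
    by rewrite -hE /h (negPf ys) py.
  have [_|_] := eqVneq a z; first by have := hq b; case: eqP => _; lia.
  have [bz|_] := eqVneq b z; last by [].
  rewrite bz e_sym in ab; have [_ <-] := h_leaf _ _ ab zs.
  by rewrite /h (negPf zs) pz; lia.
have H_path a p : path e a p -> H (last a p) <= H a + size p.
  elim: p a => [|b p IH] a /=; first by rewrite addn0.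
  by move=> /andP[/H_step ab /IH]; lia.
have [p [yp lp sp]] := gdist_walk (conn y z).
have yz : z != y by apply: contra_eq_neq pz => ->; rewrite py; lia.
have := H_path _ _ yp; rewrite lp sp /H eqxx eqxx (negPf yz) add0n => qd.
apply: leq_trans qd _; rewrite /diameter.
by apply: leq_trans (leq_bigmax y); apply: (leq_bigmax (F := gdist e y)).
Qed.

End Caterpillar.

(** * Bounding the trimmed path by the dimension and applying the labelling *)

Theorem theorem16 (k : nat) (T : finType) (e : rel T)
  (e_sym : symmetric e) (e_irr : irreflexive e)
  (e_cat : is_caterpillar e) (e_diam : diameter e = k.+1)
  (e_odd : forall x : T, odd (degree e x))
  (T_large : 2 ^ k <= #|T|) (T_pow2 : exists n : nat, #|T| = 2 ^ n) :
  set_sequential e.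
Proof.
have [n cardT] := T_pow2; have [[conn acyc] _] := e_cat.
have [s0 /(dominating_path_shrink e_sym)[s [ds ends]]] :=
  caterpillar_dominating_path e_cat.
have [s_neq0 _ us _] := ds.
have [x0 _] : exists x0, x0 \in s by case: (s) s_neq0 => // x u; exists x; rewrite mem_head.
have adj := spine_adjacent e_sym e_irr acyc ds x0.
have padj := adj_parent e_sym acyc ds x0.
have kn : k <= n by rewrite -(leq_exp2l _ _ (ltnSn 1)) -cardT.
have q0 : 0 < size s by rewrite lt0n size_eq0.
apply: (@spine_set_sequential _ _ x0 s (parent e s) e_sym us adj _ padj _ e_odd n) => //.
- exact: parent_lt.
- exact: leaves_nonadjacent.
(* A path with at least two vertices is shorter than the diameter [k.+1], hence has at most [k <= n]
   vertices. For a single vertex only [0 < n] is needed, and an odd degree forces a second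
   vertex. *)
- have [s1|s1] := leqP (size s) 1; last first.
    have [d0 d1] := ends s1 x0.
    have := size_dominating_path e_sym e_irr acyc ds conn s1 d0 d1.
    by rewrite e_diam ltnS => /leq_trans; apply.
  apply: leq_trans s1 _; rewrite lt0n; apply: contraL (e_odd x0) => /eqP n0.
  rewrite (_ : degree e x0 = 0) //; apply/eqP; rewrite cards_eq0.
  apply/eqP/setP => y; rewrite !inE; apply/negP => xy.
  have : 1 < #|T| by apply/card_gt1P; exists x0, y; split=> //; apply: contraTneq xy => ->; rewrite e_irr.
  by rewrite cardT n0.
(* Trimming handles the two ends; an inner vertex has two neighbours on the path. *)
move=> s1 i iq; have [d0 d1] := ends s1 x0.
have [->//|i0] := posnP i.
have [iE|i1] := eqVneq i.+1 (size s); first by rewrite -iE in d1.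
rewrite (degree_spine us adj padj iq) i0.
by have -> : i.+1 < size s by lia.
Qed.
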